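(* The category $SGp$ of soft groups is a symmetric monoidal category, with monoidal product given by the categorical product (the soft product $\hat{\times}$) and unit object given by the final object.
   Context: A soft group $(F,A)_G$ over a group $G$ is a pair consisting of a set $A$ of parameters (a subset of some set $E$ of parameters) and a function $F:A\to P(G)$ into the power set of $G$ such that $F(a)$ is a subgroup of $G$ for every $a\in A$. For a group homomorphism $f:G\to K$, $\hat f:P(G)\to P(K)$ denotes the direct image map $\hat f(S)=f(S)$. A soft group homomorphism $(f,p):(F,A)_G\to(H,B)_K$ is a pair consisting of a group homomorphism $f:G\to K$ and a function $p:A\to B$ such that $\hat f\circ F=H\circ p$. Two soft group homomorphisms $(f,p)$ and $(g,q)$ are equal if and only if $f=g$ and $p=q$. $SGp$ is the category whose objects are soft groups (over arbitrary groups and parameter sets), whose morphisms are soft group homomorphisms, with componentwise composition $(g,q)\circ(f,p)=(g\circ f,q\circ p)$ and identities $(1_G,1_A)$. The soft product of $(F_1,A_1)_{G_1}$ and $(F_2,A_2)_{G_2}$ is the soft group $(U,A_1\times A_2)_{G_1\times G_2}$ over the direct product group with $U(x,y)=F_1(x)\times F_2(y)$ for all $(x,y)\in A_1\times A_2$; with the morphisms whose components are the group projections and the parameter-set projections it serves as the categorical product in $SGp$. The final object is the soft group $(F,\{a\})_{\{e\}}$ over the trivial group $\{e\}$ with singleton parameter set $\{a\}$ and $F(a)=\{e\}$.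
   Formalization: The monoidal product is the soft product, acting componentwise on morphisms; it is not claimed to be the categorical product, since with morphisms required to satisfy f^∘F = H∘p the diagonal of a nontrivial soft group is not a morphism into the soft product. *)

(* Defs.v *)
(* Mathematical Components, with the classical sets of MathComp-Analysis. *)
From HB Require Import structures.
From mathcomp Require Import all_boot.
From mathcomp Require Import boolp classical_sets.

Set Implicit Arguments.
Unset Strict Implicit.
Unset Printing Implicit Defensive.

Local Open Scope classical_set_scope.
Local Open Scope group_scope.

(** * Categories *)

Record category := Category {
  obj :> Type;
  hom : obj -> obj -> Type;
  idm : forall X, hom X X;
  comp : forall X Y Z, hom Y Z -> hom X Y -> hom X Z;
  comp1m : forall X Y (f : hom X Y), comp (idm Y) f = f;
  compm1 : forall X Y (f : hom X Y), comp f (idm X) = f;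
  compA : forall X Y Z W (h : hom Z W) (g : hom Y Z) (f : hom X Y),
    comp h (comp g f) = comp (comp h g) f }.

Arguments hom {c} X Y.
Arguments idm {c} X.
Arguments comp {c X Y Z} g f.

Declare Scope cat_scope.
Delimit Scope cat_scope with cat.
Notation "g \oc f" := (comp g f) (at level 40, left associativity) : cat_scope.
Local Open Scope cat_scope.

Definition is_iso (C : category) (X Y : C) (f : hom X Y) : Prop :=
  exists g : hom Y X, g \oc f = idm X /\ f \oc g = idm Y.

Definition is_final (C : category) (I : C) : Prop :=
  forall X : C, exists! f : hom X I, True.

(* [symmetric_monoidal ot otm I]: the operations [ot] on objects and [otm] on
   morphisms form a bifunctor, and (C, ot, I) carries associativity, unit and
   symmetry constraints, natural and subject to Mac Lane's axioms. *)
Record symmetric_monoidal (C : category) (ot : C -> C -> C)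
    (otm : forall {X X' Y Y' : C},
       hom X X' -> hom Y Y' -> hom (ot X Y) (ot X' Y'))
    (I : C) : Type := SymmetricMonoidal {
  otm_id : forall X Y : C, otm (idm X) (idm Y) = idm (ot X Y);
  otm_comp : forall (X X' X'' Y Y' Y'' : C)
      (f' : hom X' X'') (f : hom X X') (g' : hom Y' Y'') (g : hom Y Y'),
    otm (f' \oc f) (g' \oc g) = otm f' g' \oc otm f g;

  assoc : forall X Y Z : C, hom (ot (ot X Y) Z) (ot X (ot Y Z));
  lunit : forall X : C, hom (ot I X) X;
  runit : forall X : C, hom (ot X I) X;
  braid : forall X Y : C, hom (ot X Y) (ot Y X);

  assoc_iso : forall X Y Z : C, is_iso (assoc X Y Z);
  lunit_iso : forall X : C, is_iso (lunit X);
  runit_iso : forall X : C, is_iso (runit X);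

  assoc_natural : forall (X X' Y Y' Z Z' : C)
      (f : hom X X') (g : hom Y Y') (h : hom Z Z'),
    assoc X' Y' Z' \oc otm (otm f g) h = otm f (otm g h) \oc assoc X Y Z;
  lunit_natural : forall (X X' : C) (f : hom X X'),
    lunit X' \oc otm (idm I) f = f \oc lunit X;
  runit_natural : forall (X X' : C) (f : hom X X'),
    runit X' \oc otm f (idm I) = f \oc runit X;
  braid_natural : forall (X X' Y Y' : C) (f : hom X X') (g : hom Y Y'),
    braid X' Y' \oc otm f g = otm g f \oc braid X Y;

  pentagon : forall W X Y Z : C,
    assoc W X (ot Y Z) \oc assoc (ot W X) Y Z =
    otm (idm W) (assoc X Y Z) \oc assoc W (ot X Y) Z
      \oc otm (assoc W X Y) (idm Z);
  triangle : forall X Y : C,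
    otm (idm X) (lunit Y) \oc assoc X I Y = otm (runit X) (idm Y);
  hexagon : forall X Y Z : C,
    assoc Y Z X \oc braid X (ot Y Z) \oc assoc X Y Z =
    otm (idm Y) (braid X Z) \oc assoc Y X Z \oc otm (braid X Y) (idm Z);
  symmetry : forall X Y : C, braid Y X \oc braid X Y = idm (ot X Y) }.

(** * Soft groups *)

(* [groupType] groups are possibly infinite; the choice operator it bundles is
   available on every type under the axioms of [boolp], and homomorphisms
   ignore it. *)

Definition is_subgroup (G : groupType) (S : set G) : Prop :=
  [/\ S 1, forall x y, S x -> S y -> S (x * y) & forall x, S x -> S x^-1].

Record softGroup := SoftGroup {
  sgroup : groupType;
  sparam : Type;
  sfun :> sparam -> set sgroup;
  sfun_subgroup : forall a, is_subgroup (sfun a) }.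

Arguments sfun : clear implicits.

Definition dimage (G K : Type) (f : G -> K) : set G -> set K :=
  fun S => f @` S.

Record softHom (X Y : softGroup) := SoftHom {
  hgrp : UMagmaMorphism.type (sgroup X) (sgroup Y);
  hpar : sparam X -> sparam Y;
  softHomE : dimage hgrp \o sfun X = sfun Y \o hpar }.

Lemma softHom_eq (X Y : softGroup) (u v : softHom X Y) :
  hgrp u =1 hgrp v -> hpar u =1 hpar v -> u = v.
Proof.
case: u v => [f p fp] [g q gq] /= /funext fg /funext pq.
have {}fg : f = g.
  case: f g fg {fp gq} => [f [[f1] [f2]]] [g [[g1] [g2]]] /= fg.
  by subst g; rewrite (Prop_irrelevance f1 g1) (Prop_irrelevance f2 g2).
by subst g q; rewrite (Prop_irrelevance fp gq).
Qed.

Lemma softHom_image (X Y : softGroup) (u : softHom X Y) (a : sparam X) :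
  hgrp u @` X a = Y (hpar u a).
Proof. exact: (congr1 (fun F => F a) (softHomE u)). Qed.

Section SoftHomOps.
Variables X Y Z : softGroup.

Fact soft_id_subproof :
  dimage (idfun : UMagmaMorphism.type (sgroup X) (sgroup X)) \o sfun X
    = sfun X \o idfun.
Proof. by apply/funext => a /=; rewrite /dimage image_id. Qed.

Definition soft_id : softHom X X := SoftHom soft_id_subproof.

Variables (v : softHom Y Z) (u : softHom X Y).

Fact soft_comp_subproof :
  dimage (hgrp v \o hgrp u : UMagmaMorphism.type (sgroup X) (sgroup Z))
    \o sfun X = sfun Z \o (hpar v \o hpar u).
Proof.
apply/funext => a; rewrite /dimage.
transitivity (hgrp v @` (hgrp u @` X a)); first by rewrite image_comp.
by rewrite !softHom_image.
Qed.

Definition soft_comp : softHom X Z := SoftHom soft_comp_subproof.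

End SoftHomOps.

Fact soft_comp1m (X Y : softGroup) (u : softHom X Y) :
  soft_comp (soft_id Y) u = u.
Proof. exact: softHom_eq. Qed.

Fact soft_compm1 (X Y : softGroup) (u : softHom X Y) :
  soft_comp u (soft_id X) = u.
Proof. exact: softHom_eq. Qed.

Fact soft_compA (X Y Z W : softGroup)
    (w : softHom Z W) (v : softHom Y Z) (u : softHom X Y) :
  soft_comp w (soft_comp v u) = soft_comp (soft_comp w v) u.
Proof. exact: softHom_eq. Qed.

Definition SGp : category := Category soft_comp1m soft_compm1 soft_compA.

(** * Soft product and final soft group *)

(* The projections are soft homomorphisms out of [soft_prod X Y], but a pair of
   soft homomorphisms Z -> X, Z -> Y need not factor through it: for the two
   identities of X, the image of [X a] under the diagonal is in general a
   proper subset of [X a `*` X a].  No pairing is therefore available, and the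
   action on morphisms below is the componentwise one. *)

Section SoftProd.
Variables X Y : softGroup.

Definition soft_prod_fun (ab : sparam X * sparam Y) :
  set (sgroup X * sgroup Y)%type := X ab.1 `*` Y ab.2.

Fact soft_prod_subgroup ab :
  is_subgroup (soft_prod_fun ab : set (sgroup X * sgroup Y)%type).
Proof.
have [X1 XM XV] := sfun_subgroup ab.1.
have [Y1 YM YV] := sfun_subgroup ab.2.
split=> //= [x y [? ?] [? ?]|x [? ?]]; split;
  by [apply: XM|apply: YM|apply: XV|apply: YV].
Qed.

Definition soft_prod : SGp := SoftGroup soft_prod_subgroup.

End SoftProd.

Section GroupProdMap.
Variables (G G' H H' : groupType).
Variables (f : UMagmaMorphism.type G G') (g : UMagmaMorphism.type H H').

Definition prod_map (x : G * H) : G' * H' := (f x.1, g x.2).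

Fact prod_map_morphism : monoid_morphism prod_map.
Proof.
by split=> [|x y]; rewrite /prod_map ?gmulf1// !gmulfM.
Qed.

HB.instance Definition _ :=
  isUMagmaMorphism.Build (G * H)%type (G' * H')%type prod_map
    prod_map_morphism.

End GroupProdMap.

Section SoftProdMap.
Variables (X X' Y Y' : softGroup) (u : softHom X X') (v : softHom Y Y').

Definition param_prod_map (ab : sparam X * sparam Y) : sparam X' * sparam Y' :=
  (hpar u ab.1, hpar v ab.2).

Fact soft_prod_map_subproof :
  dimage (prod_map (hgrp u) (hgrp v)) \o sfun (soft_prod X Y)
    = sfun (soft_prod X' Y') \o param_prod_map.
Proof.
apply/funext => -[a b]; rewrite /= /dimage /soft_prod_fun /=.
rewrite -!softHom_image; apply/seteqP; split.
  by move=> _ [[x y] /= [Xx Yy] <-]; split; [exists x|exists y].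
by move=> [_ _] [/= [x Xx <-] [y Yy <-]]; exists (x, y).
Qed.

Definition soft_prod_map : softHom (soft_prod X Y) (soft_prod X' Y') :=
  @SoftHom (soft_prod X Y) (soft_prod X' Y')
    (prod_map (hgrp u) (hgrp v) : UMagmaMorphism.type
       (sgroup X * sgroup Y)%type (sgroup X' * sgroup Y')%type)
    param_prod_map soft_prod_map_subproof.

End SoftProdMap.

Section UnitGroup.
Let unit_inv (_ : unit) := tt.
Let unit_mul (_ _ : unit) := tt.
Fact unit_mulgA : associative unit_mul. Proof. by []. Qed.
Fact unit_mul1g : left_id tt unit_mul. Proof. by case. Qed.
Fact unit_mulg1 : right_id tt unit_mul. Proof. by case. Qed.
Fact unit_mulVg : left_inverse tt unit_inv unit_mul. Proof. by []. Qed.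
Fact unit_mulgV : right_inverse tt unit_inv unit_mul. Proof. by []. Qed.
HB.instance Definition _ :=
  isGroup.Build unit unit_mulgA unit_mul1g unit_mulg1 unit_mulVg unit_mulgV.
End UnitGroup.

Fact soft_final_subgroup (a : unit) : is_subgroup ([set 1] : set unit).
Proof. by split=> //= [[] []|[]]. Qed.

Definition soft_final : SGp :=
  @SoftGroup unit unit (fun=> [set 1]) soft_final_subgroup.

(* Main.v *)
From HB Require Import structures.
From mathcomp Require Import all_boot.
From mathcomp Require Import boolp classical_sets.
Require Import Defs.

(** The constraints are those of the cartesian products of the underlying
    groups and of the parameter sets: reassociating, deleting a trivial factor,
    swapping.  Each is a bijective group homomorphism together with a bijection
    of parameters, and a value of the soft product is a product of subgroups, so
    an element lies in a value exactly when its image lies in the corresponding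
    value.  Such a pair of bijections is an isomorphism of soft groups
    ([iso_of_is_iso]).  Since a soft homomorphism is determined by its two
    components ([softHom_eq]), naturality and coherence are identities between
    functions on tuples, which hold because both sides rearrange coordinates in
    the same way. *)

Set Implicit Arguments.
Unset Strict Implicit.
Unset Printing Implicit Defensive.

Local Open Scope classical_set_scope.
Local Open Scope group_scope.
Local Open Scope cat_scope.

Section SoftHomOf.
Variables (X Y : softGroup) (f : sgroup X -> sgroup Y).
Variables (p : sparam X -> sparam Y).
Hypotheses (fM : monoid_morphism f) (fX : forall a, f @` X a = Y (p a)).

Let f_umagma : UMagmaMorphism.type (sgroup X) (sgroup Y) :=
  HB.pack f (isUMagmaMorphism.Build _ _ f fM).

Fact hom_of_subproof : dimage f_umagma \o sfun X = sfun Y \o p.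
Proof. by apply/funext => a; exact: fX. Qed.

Definition hom_of : softHom X Y := SoftHom hom_of_subproof.

End SoftHomOf.

(** The subset condition has to be an equivalence: a bijective soft homomorphism
    must carry [X a] onto [Y (p a)], and not merely into it. *)
Record soft_bij (X Y : softGroup) := SoftBij {
  bgrp : sgroup X -> sgroup Y;
  bgrpV : sgroup Y -> sgroup X;
  bpar : sparam X -> sparam Y;
  bparV : sparam Y -> sparam X;
  bgrpM : monoid_morphism bgrp;
  bgrpK : cancel bgrp bgrpV;
  bgrpVK : cancel bgrpV bgrp;
  bparK : cancel bpar bparV;
  bparVK : cancel bparV bpar;
  bgrpP : forall a x, Y (bpar a) (bgrp x) <-> X a x }.

Lemma soft_bij_image (X Y : softGroup) (b : soft_bij X Y) a :
  bgrp b @` X a = Y (bpar b a).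
Proof.
apply/seteqP; split=> [_ [x Xx <-]|y Yy]; first exact/bgrpP.
by exists (bgrpV b y); [apply/(bgrpP b)|]; rewrite bgrpVK.
Qed.

Definition iso_of (X Y : softGroup) (b : soft_bij X Y) : softHom X Y :=
  hom_of (bgrpM b) (soft_bij_image b).

Lemma bgrpV_morphism (X Y : softGroup) (b : soft_bij X Y) :
  monoid_morphism (bgrpV b).
Proof.
have [f1 fM] := bgrpM b.
split=> [|x y]; first by rewrite -f1 bgrpK.
by apply: (can_inj (bgrpK b)); rewrite fM !bgrpVK.
Qed.

Lemma bgrpVP (X Y : softGroup) (b : soft_bij X Y) c y :
  X (bparV b c) (bgrpV b y) <-> Y c y.
Proof. by rewrite -(bgrpP b) bgrpVK bparVK. Qed.

Definition soft_bijV (X Y : softGroup) (b : soft_bij X Y) : soft_bij Y X :=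
  SoftBij (bgrpV_morphism b) (bgrpVK b) (bgrpK b) (bparVK b) (bparK b)
    (bgrpVP b).

Lemma iso_of_is_iso (X Y : SGp) (b : soft_bij X Y) :
  is_iso (iso_of b : hom X Y).
Proof.
exists (iso_of (soft_bijV b)); split; apply: softHom_eq => x /=.
- exact: bgrpK.
- exact: bparK.
- exact: bgrpVK.
- exact: bparVK.
Qed.

(** * The constraints *)

Definition pair_assoc (A B C : Type) (x : A * B * C) : A * (B * C) :=
  (x.1.1, (x.1.2, x.2)).
Definition pair_assocV (A B C : Type) (x : A * (B * C)) : A * B * C :=
  (x.1, x.2.1, x.2.2).

Lemma pair_assocK (A B C : Type) :
  cancel (@pair_assoc A B C) (@pair_assocV A B C).
Proof. by case=> -[]. Qed.

Lemma pair_assocVK (A B C : Type) :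
  cancel (@pair_assocV A B C) (@pair_assoc A B C).
Proof. by case=> ? []. Qed.

Lemma pair_ttK (A : Type) : cancel (@fst A unit) (pair^~ tt).
Proof. by case=> ? []. Qed.

Lemma tt_pairK (A : Type) : cancel (@snd unit A) (pair tt).
Proof. by case=> -[]. Qed.

Definition pair_swap (A B : Type) (x : A * B) : B * A := (x.2, x.1).

Lemma pair_swapK (A B : Type) : cancel (@pair_swap A B) (@pair_swap B A).
Proof. by case. Qed.

Section Constraints.
Variables X Y Z : softGroup.

Fact assoc_morphism :
  monoid_morphism (@pair_assoc (sgroup X) (sgroup Y) (sgroup Z)).
Proof. by []. Qed.

Fact assocP (a : sparam X * sparam Y * sparam Z)
    (x : sgroup X * sgroup Y * sgroup Z) :
  soft_prod X (soft_prod Y Z) (pair_assoc a) (pair_assoc x) <->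
  soft_prod (soft_prod X Y) Z a x.
Proof. by split=> [[? []]|[[]]]. Qed.

Definition assoc_bij :
    soft_bij (soft_prod (soft_prod X Y) Z) (soft_prod X (soft_prod Y Z)) :=
  @SoftBij (soft_prod (soft_prod X Y) Z) (soft_prod X (soft_prod Y Z))
    _ _ _ _ assoc_morphism (@pair_assocK _ _ _) (@pair_assocVK _ _ _)
    (@pair_assocK _ _ _) (@pair_assocVK _ _ _) assocP.

Fact lunit_morphism : monoid_morphism (@snd unit (sgroup X)).
Proof. by []. Qed.

Fact lunitP (a : unit * sparam X) (x : unit * sgroup X) :
  X a.2 x.2 <-> soft_prod soft_final X a x.
Proof. by case: x => [[] x]; split=> [|[]]. Qed.

Definition lunit_bij : soft_bij (soft_prod soft_final X) X :=
  @SoftBij (soft_prod soft_final X) X _ _ _ _ lunit_morphism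
    (@tt_pairK _) (fun=> erefl) (@tt_pairK _) (fun=> erefl) lunitP.

Fact runit_morphism : monoid_morphism (@fst (sgroup X) unit).
Proof. by []. Qed.

Fact runitP (a : sparam X * unit) (x : sgroup X * unit) :
  X a.1 x.1 <-> soft_prod X soft_final a x.
Proof. by case: x => [x []]; split=> [|[]]. Qed.

Definition runit_bij : soft_bij (soft_prod X soft_final) X :=
  @SoftBij (soft_prod X soft_final) X _ _ _ _ runit_morphism
    (@pair_ttK _) (fun=> erefl) (@pair_ttK _) (fun=> erefl) runitP.

Fact braid_morphism : monoid_morphism (@pair_swap (sgroup X) (sgroup Y)).
Proof. by []. Qed.

Fact braidP (a : sparam X * sparam Y) (x : sgroup X * sgroup Y) :
  soft_prod Y X (pair_swap a) (pair_swap x) <-> soft_prod X Y a x.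
Proof. by split=> [[]|[]]. Qed.

Definition braid_bij : soft_bij (soft_prod X Y) (soft_prod Y X) :=
  @SoftBij (soft_prod X Y) (soft_prod Y X) _ _ _ _ braid_morphism
    (@pair_swapK _ _) (@pair_swapK _ _) (@pair_swapK _ _) (@pair_swapK _ _) braidP.

End Constraints.

(** * The final object *)

Section ToFinal.
Variable X : softGroup.

Fact to_final_morphism : monoid_morphism (fun _ : sgroup X => tt).
Proof. by []. Qed.

(** The image of [X a] is nonempty, hence all of the trivial group, because
    [X a] contains 1. *)
Fact to_final_image (a : sparam X) :
  (fun _ : sgroup X => tt) @` X a = soft_final tt :> set unit.
Proof.
have [X1 _ _] := sfun_subgroup a.
by apply/seteqP; split=> [[]|[] _] //; exists 1.
Qed.

Definition to_final : softHom X soft_final :=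
  @hom_of X soft_final _ (fun=> tt) to_final_morphism to_final_image.

End ToFinal.

Lemma soft_final_final : is_final soft_final.
Proof.
move=> X; exists (to_final X); split=> // u _.
by apply: softHom_eq => x /=; [case: (hgrp u x)|case: (hpar u x)].
Qed.

Lemma SGp_symmetric_monoidal :
  @symmetric_monoidal SGp soft_prod soft_prod_map soft_final.
Proof.
apply: (@SymmetricMonoidal SGp soft_prod soft_prod_map soft_final _ _
  (fun X Y Z => iso_of (assoc_bij X Y Z)) (fun X => iso_of (lunit_bij X))
  (fun X => iso_of (runit_bij X)) (fun X Y => iso_of (braid_bij X Y))).
all: try by move=> *; apply: iso_of_is_iso.
(* Once the tuples are destructed, both sides of each axiom compute to the same
   tuple. *)
all: by move=> *; apply: softHom_eq; do ?case.
Qed.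

Theorem mainTheorem9 :
  is_final soft_final /\
  inhabited (@symmetric_monoidal SGp soft_prod soft_prod_map soft_final).
Proof.
split; first exact: soft_final_final.
exact: inhabits SGp_symmetric_monoidal.
Qed.
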